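(* Let $p\ge 3$ and, for $j=1,\dots,p$, let $A_j$ be a finite set with $m_j\ge 2$ elements; put $\Omega_p=A_1\times\dots\times A_p$. For an integer $L\ge 1$ consider the Hamming mixture model $$h(\boldsymbol x\mid\boldsymbol c_1,\dots,\boldsymbol c_L,\boldsymbol\sigma_1,\dots,\boldsymbol\sigma_L,\boldsymbol\pi,L)=\sum_{l=1}^L\pi_l\,p(\boldsymbol x\mid\boldsymbol c_l,\boldsymbol\sigma_l),\qquad \boldsymbol x\in\Omega_p,$$ with centers $\boldsymbol c_l\in\Omega_p$, scales $\boldsymbol\sigma_l\in(0,\infty)^p$ and weights $\boldsymbol\pi=(\pi_1,\dots,\pi_L)$, $0\le\pi_l\le 1$, $\sum_{l=1}^L\pi_l=1$, where $p(\cdot\mid\boldsymbol c,\boldsymbol\sigma)$ is the $\mathrm{Hamming}(\boldsymbol c,\boldsymbol\sigma)$ probability mass function. If $$p\ge 2\lceil\log_2 L\rceil+1,$$ then the parameters of the Hamming mixture model are generically $L!$-identifiable.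
   Context: $\lceil x\rceil$ is the smallest integer at least as large as $x$. $\delta_a(b)$ is the Kronecker delta. The $\mathrm{Hamming}(\boldsymbol c,\boldsymbol\sigma)$ distribution on $\Omega_p$, with $\boldsymbol c=(c_1,\dots,c_p)\in\Omega_p$ and $\boldsymbol\sigma=(\sigma_1,\dots,\sigma_p)\in(0,\infty)^p$, has probability mass function $$p(\boldsymbol x\mid\boldsymbol c,\boldsymbol\sigma)=\frac{1}{\prod_{j=1}^p\left(1+\frac{m_j-1}{\exp(1/\sigma_j)}\right)}\exp\!\left(-\sum_{j=1}^p\frac{1-\delta_{c_j}(x_j)}{\sigma_j}\right),\qquad \boldsymbol x=(x_1,\dots,x_p)\in\Omega_p.$$ $L!$-identifiability means identifiability up to permutation of the component labels: a parameter $(\pi_l,\boldsymbol c_l,\boldsymbol\sigma_l)_{l=1}^L$ is $L!$-identifiable if every parameter $(\pi'_l,\boldsymbol c'_l,\boldsymbol\sigma'_l)_{l=1}^L$ of the $L$-component model giving the same probability mass function $h$ on $\Omega_p$ is of the form $(\pi_{\tau(l)},\boldsymbol c_{\tau(l)},\boldsymbol\sigma_{\tau(l)})_{l=1}^L$ for some permutation $\tau$ of $\{1,\dots,L\}$. The model is generically $L!$-identifiable if the set of parameters that are not $L!$-identifiable has Lebesgue measure zero; here the centers range over a finite set, so this means that for each $(\boldsymbol c_1,\dots,\boldsymbol c_L)\in\Omega_p^L$ the set of non-identifiable $(\boldsymbol\pi,\boldsymbol\sigma_1,\dots,\boldsymbol\sigma_L)$ is null for Lebesgue measure on (the $(L-1)$-dimensional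 simplex) $\times(0,\infty)^{pL}$. *)

(* Defs.v *)
From HB Require Import structures.
From mathcomp Require Import all_boot all_order all_algebra all_fingroup.
From mathcomp Require Import all_classical all_reals all_analysis.
Import Order.TTheory GRing.Theory Num.Theory.
Import numFieldNormedType.Exports.

Set Implicit Arguments.
Unset Strict Implicit.
Unset Printing Implicit Defensive.

Local Open Scope classical_set_scope.
Local Open Scope ring_scope.

(* n-fold product of a measure, on [n.-tuple T] with its product sigma-algebra;
   [prod_measureE] below characterizes it by its values on boxes. *)
Fixpoint prod_measure d (T : measurableType d) (R : realType)
    (mu : set T -> \bar R) (n : nat) : set (n.-tuple T) -> \bar R :=
  match n with
  | 0 => \d_([tuple] : 0.-tuple T)
  | m.+1 => pushforward (product_measure1 mu (@prod_measure d T R mu m))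
              (fun z : T * m.-tuple T => [tuple of z.1 :: z.2])
  end.
Arguments prod_measure {d T R} mu n _.

Definition of_sigma_finite d (T : measurableType d) (R : realType)
  (mu : {measure set T -> \bar R}) of sigma_finite setT mu :
  set T -> \bar R := mu.

HB.instance Definition _ d (T : measurableType d) (R : realType)
    (mu : {measure set T -> \bar R}) (muf : sigma_finite setT mu) :=
  Measure.on (of_sigma_finite muf).

HB.instance Definition _ d (T : measurableType d) (R : realType)
    (mu : {measure set T -> \bar R}) (muf : sigma_finite setT mu) :=
  Measure_isSigmaFinite.Build _ _ _ (of_sigma_finite muf) muf.

Lemma prod_measure_sigma_finite d (T : measurableType d) (R : realType)
    (mu : {sigma_finite_measure set T -> \bar R}) (n : nat) :
  {nu : {sigma_finite_measure set (n.-tuple T) -> \bar R} |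
    prod_measure mu n = nu}.
Proof.
elim: n => [|n [nu munu]] /=; first by exists (\d_([tuple] : 0.-tuple T)).
rewrite munu.
pose cons2 (z : T * n.-tuple T) : n.+1.-tuple T := [tuple of z.1 :: z.2].
have mcons : measurable_fun [set: T * n.-tuple T] cons2.
  by apply: measurable_cons; [exact: measurable_fst|exact: measurable_snd].
pose uncons (t : n.+1.-tuple T) : T * n.-tuple T :=
  (tnth t ord0, [tuple of behead t]).
have muncons : measurable_fun [set: n.+1.-tuple T] uncons.
  by apply: measurable_fun_pair; [exact: measurable_tnth|exact: measurable_behead].
have consK : cancel cons2 uncons.
  case=> x t; rewrite /uncons /cons2 /=; congr pair; exact: val_inj.
pose rho : {measure set (T * n.-tuple T)%type -> \bar R} :=
  product_measure1 mu nu.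
pose PM0 := [the {measure set (n.+1.-tuple T) -> \bar R} of
  pushforward rho cons2].
pose PM := PM0 mcons.
pose P := (PM : set (n.+1.-tuple T) -> \bar R).
have Psf : sigma_finite setT P.
  have [F TF Foo] : sigma_finite setT rho.
    have /sigma_finiteP[F [TF ndF Foo]] := sigma_finiteT mu.
    have /sigma_finiteP[G [TG ndG Goo]] := sigma_finiteT nu.
    exists (fun k => F k `*` G k).
      rewrite -setXTT TF TG predeqE => -[x y]; split.
        move=> [/= [i _ Fix] [k _ Gky]]; exists (maxn i k) => //; split.
        - by move: x Fix; exact/subsetPset/ndF/leq_maxl.
        - by move: y Gky; exact/subsetPset/ndG/leq_maxr.
      by move=> [k _ []/= ? ?]; split; exists k.
    move=> k; have [? ?] := Foo k; have [? ?] := Goo k.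
    split; first exact: measurableX.
    by rewrite /rho /= product_measure1E// lte_mul_pinfty// ge0_fin_numE.
  exists (fun k => uncons @^-1` F k).
    by rewrite -preimage_bigcup -TF preimage_setT.
  move=> k; have [mF rF] := Foo k; split.
    by rewrite -[X in measurable X]setTI; exact: muncons.
  rewrite /P /= /pushforward -comp_preimage.
  rewrite (_ : (uncons \o cons2) @^-1` F k = F k)//.
  by apply/seteqP; split => z /=; rewrite consK.
by exists (of_sigma_finite Psf).
Qed.

Lemma prod_measureE d (T : measurableType d) (R : realType)
    (mu : {sigma_finite_measure set T -> \bar R}) (n : nat)
    (B : 'I_n -> set T) : (forall i, measurable (B i)) ->
  prod_measure mu n [set t | forall i, B i (tnth t i)] =
    (\prod_(i < n) mu (B i))%E.
Proof.
elim: n B => [|n IH] B mB /=.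
  rewrite big_ord0 diracE mem_set//= => -[]//.
have [nu munu] := prod_measure_sigma_finite mu n.
rewrite big_ord_recl /pushforward -(IH (fun i => B (lift ord0 i)))// munu.
rewrite -product_measure1E//; last first.
  rewrite (_ : [set _ | _] = \bigcap_(i in [set: 'I_n])
      ((fun t : n.-tuple T => tnth t i) @^-1` B (lift ord0 i))); last first.
    by apply/seteqP; split => t /= h i; [move=> _; exact: h|exact: h].
  apply: fin_bigcap_measurable; first exact: finite_finset.
  by move=> i _; rewrite -[X in measurable X]setTI; exact: measurable_tnth.
congr (_ _); apply/seteqP; split => -[x t] /=.
  move=> h; split; first by have := h ord0.
  by move=> i; have := h (lift ord0 i); rewrite tnthS.
move=> [Bx h] i; case: (unliftP ord0 i) => [j ->|->]; last exact: Bx.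
by rewrite tnthS; exact: h.
Qed.

Definition Omega (p : nat) (A : 'I_p -> finType) : finType :=
  {dffun forall j : 'I_p, A j}.

Definition hamming_pmf (R : realType) (p : nat) (A : 'I_p -> finType)
    (c : Omega A) (sigma : 'I_p -> R) (x : Omega A) : R :=
  (\prod_(j < p) (1 + (#|A j|%:R - 1) / expR (1 / sigma j)))^-1 *
  expR (- \sum_(j < p) (1 - (x j == c j)%:R) / sigma j).

Record mix_param (R : realType) (p : nat) (A : 'I_p -> finType) (L : nat) :=
  MixParam {
    weight : 'I_L -> R;
    center : 'I_L -> Omega A;
    scale : 'I_L -> 'I_p -> R }.

Definition admissible (R : realType) (p : nat) (A : 'I_p -> finType) (L : nat)
    (th : mix_param R A L) : Prop :=
  [/\ forall l, 0 <= weight th l <= 1,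
      \sum_(l < L) weight th l = 1 &
      forall l j, 0 < scale th l j].

Definition mixture_pmf (R : realType) (p : nat) (A : 'I_p -> finType) (L : nat)
    (th : mix_param R A L) (x : Omega A) : R :=
  \sum_(l < L) weight th l * hamming_pmf (center th l) (scale th l) x.

Definition identifiable (R : realType) (p : nat) (A : 'I_p -> finType)
    (L : nat) (th : mix_param R A L) : Prop :=
  forall th' : mix_param R A L, admissible th' ->
    (forall x, mixture_pmf th' x = mixture_pmf th x) ->
    exists tau : {perm 'I_L}, forall l,
      [/\ weight th' l = weight th (tau l),
          center th' l = center th (tau l) &
          forall j, scale th' l j = scale th (tau l) j].

(* The (L-1)-dimensional simplex is parametrized by its first L-1 coordinates;
   the scales are a point of (R^p)^L. *)
Definition continuous_coords (R : realType) (p : nat) (A : 'I_p -> finType)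
    (L : nat) (th : mix_param R A L) :
    L.-1.-tuple (measurableTypeR R) * L.-tuple (p.-tuple (measurableTypeR R)) :=
  ([tuple weight th (widen_ord (leq_pred L) i) | i < L.-1],
   [tuple [tuple scale th l j | j < p] | l < L]).

Definition coords_lebesgue (R : realType) (p L : nat) :
    set (L.-1.-tuple (measurableTypeR R) *
         L.-tuple (p.-tuple (measurableTypeR R)))%type -> \bar R :=
  product_measure1
    (prod_measure (@lebesgue_measure R) L.-1)
    (prod_measure (prod_measure (@lebesgue_measure R) p) L).

Definition generically_identifiable (R : realType) (p : nat)
    (A : 'I_p -> finType) (L : nat) : Prop :=
  forall c : 'I_L -> Omega A,
    (@coords_lebesgue R p L).-negligible
      [set continuous_coords th | th in
        [set th : mix_param R A L |
          [/\ admissible th, center th = c & ~ identifiable th]]].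

(* Main.v *)
Require Import Defs.
From mathcomp Require Import all_boot all_order all_algebra.
From mathcomp Require Import all_fingroup.
From mathcomp Require Import all_classical all_reals all_analysis.
From mathcomp Require Import measurable_realfun ring lra zify.
Import Order.TTheory GRing.Theory Num.Theory.
Import numFieldNormedType.Exports.

(* Let [2 k < p] and [L <= 2 ^ k]. On each coordinate fix a function of mean
   zero for the uniform law that vanishes nowhere; its mean [t l j] under
   component [l] is a non-zero constant times an injective function of the
   scale. The joint moments over the first [k] coordinates, over the next [k]
   coordinates, and over coordinate [2 k] give the three-way decomposition
   [sum_l weight_l A_il B_i'l t_l], where the entries of [A] and [B] are
   products of some [t l j]. If [A] and [B] are invertible, the weights are
   non-zero and the [t l (2 k)] are distinct, then simultaneous diagonalization
   shows that any other parameter has the same [A], [B] and weights up to a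
   permutation of the labels; inverting [A] or [B] then recovers all the
   one-coordinate marginals, hence the centers and scales. The exceptional
   parameters are zeros of functions that are polynomial in an injective
   function of each variable and not identically zero. *)

Set Implicit Arguments.
Unset Strict Implicit.
Unset Printing Implicit Defensive.

Local Open Scope classical_set_scope.
Local Open Scope ring_scope.

(** * Null zero sets *)

Definition upd (T : Type) n (t : n.-tuple T) (i : 'I_n) (x : T) : n.-tuple T :=
  [tuple if j == i then x else tnth t j | j < n].

Lemma upd_cons0 (T : Type) n (x y : T) (t : n.-tuple T) :
  upd [tuple of y :: t] ord0 x = [tuple of x :: t].
Proof.
apply: eq_from_tnth => j; rewrite tnth_mktuple.
by case: (unliftP ord0 j) => [i ->|->]; rewrite ?eqxx// !tnthS.
Qed.

Lemma upd_consS (T : Type) n (x y : T) (t : n.-tuple T) i :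
  upd [tuple of y :: t] (lift ord0 i) x = [tuple of y :: upd t i x].
Proof.
apply: eq_from_tnth => j; rewrite tnth_mktuple.
case: (unliftP ord0 j) => [l ->|->]; last by [].
by rewrite !tnthS tnth_mktuple (inj_eq lift_inj).
Qed.

Lemma measurable_zeros d (T : measurableType d) (R : realType) (f : T -> R) :
  measurable_fun setT f -> measurable [set x | f x = 0].
Proof.
move=> mf; rewrite -[X in measurable X]setTI.
exact: (mf measurableT [set 0] (measurable_set1 0)).
Qed.

(** The product measure of [N] is the integral of [m2 (xsection N x)], an integrand that is zero for
    [m1]-almost every [x]. *)
Lemma product_measure1_null d1 d2 (T1 : measurableType d1)
    (T2 : measurableType d2) (R : realType) (m1 : {measure set T1 -> \bar R})
    (m2 : {sigma_finite_measure set T2 -> \bar R}) (Z : set T1)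
    (N : set (T1 * T2)) :
  measurable N -> measurable Z -> m1 Z = 0 ->
  (forall x, ~ Z x -> m2 (xsection N x) = 0) ->
  product_measure1 m1 m2 N = 0.
Proof.
move=> mN mZ Z0 NZ; rewrite /product_measure1.
rewrite (@ge0_ae_eq_integral _ _ _ m1 setT _ (cst 0%E))//.
- exact: integral0.
- exact: measurable_fun_xsection.
- exists Z; split => // x /= /not_implyP[_ xN].
  by apply: contrapT => /NZ.
Qed.

(* A non-zero function vanishes on a null set as soon as each of its
   one-variable restrictions is zero or vanishes on a null set only: by Fubini,
   freezing the first variable outside a null set leaves a non-zero function. *)
Lemma prod_measure_zeros d (T : measurableType d) (R : realType)
    (mu : {sigma_finite_measure set T -> \bar R}) n (f : n.-tuple T -> R) :
  measurable_fun setT f ->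
  (forall t i, (forall x, f (upd t i x) = 0) \/
               mu [set x | f (upd t i x) = 0] = 0) ->
  (exists t, f t != 0) -> prod_measure mu n [set t | f t = 0] = 0.
Proof.
elim: n f => [|n IH] f mf fi [t0 ft0] /=.
  rewrite diracE memNset//= => f0.
  by move: ft0; rewrite (tuple0 t0) f0 eqxx.
have [nu munu] := prod_measure_sigma_finite mu n.
rewrite /pushforward munu.
have mcons : measurable_fun setT
    (fun z : T * n.-tuple T => [tuple of z.1 :: z.2]).
  by apply: measurable_cons; [exact: measurable_fst|exact: measurable_snd].
have mcons1 x : measurable_fun setT (fun t : n.-tuple T => [tuple of x :: t]).
  by apply: measurable_cons; [exact: measurable_cst|exact: measurable_id].
pose x0 := tnth t0 ord0; pose r0 : n.-tuple T := [tuple of behead t0].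
have t0E : t0 = [tuple of x0 :: r0] by rewrite [LHS]tuple_eta.
pose Z := [set x | f [tuple of x :: r0] = 0].
have mconsr : measurable_fun setT (fun x : T => [tuple of x :: r0]).
  by apply: measurable_cons; [exact: measurable_id|exact: measurable_cst].
have mZ : measurable Z.
  apply: (@measurable_zeros _ _ _ (fun x => f [tuple of x :: r0])).
  exact: (measurableT_comp mf).
apply: (@product_measure1_null _ _ _ _ _ _ _ Z) => //.
- rewrite -[X in measurable X]setTI; apply: mcons => //.
  exact: measurable_zeros.
(* As [f t0] is non-zero, the first alternative fails for the first variable at [t0], so [Z] is
   null. *)
- have [f0|] := fi t0 ord0; last first.
    by rewrite t0E /Z; under eq_set do rewrite upd_cons0.
  by move: ft0; rewrite t0E -(upd_cons0 _ x0) -t0E f0 eqxx.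
- move=> x /eqP fx0.
  have -> : xsection ((fun z : T * n.-tuple T => [tuple of z.1 :: z.2]) @^-1`
      [set t | f t = 0]) x = [set t : n.-tuple T | f [tuple of x :: t] = 0].
    by apply/seteqP; split => /= t; rewrite /xsection/= inE.
  rewrite -munu; apply: IH.
  - exact: (measurableT_comp mf).
  - move=> t i; have := fi [tuple of x :: t] (lift ord0 i).
    under eq_set do rewrite upd_consS.
    by case=> h; [left => y; rewrite -upd_consS|right].
  - by exists r0.
Qed.

(** * Functions polynomial in given generators *)

Section generated_algebra.
Variable R : realType.

(** The subalgebra is generated inductively, so that measurability and stability under freezing
    variables follow by induction, without polynomials in several variables. *)
Inductive genalg (X : Type) (G : (X -> R) -> Prop) : (X -> R) -> Prop :=
| genalg_gen f of G f : genalg G f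
| genalg_cst c : genalg G (fun=> c)
| genalg_add f g of genalg G f & genalg G g : genalg G (fun x => f x + g x)
| genalg_mul f g of genalg G f & genalg G g : genalg G (fun x => f x * g x).

Lemma genalg_sum (X : Type) (G : (X -> R) -> Prop) (I : Type) (r : seq I)
    (P : pred I) (f : I -> X -> R) : (forall i, genalg G (f i)) ->
  genalg G (fun x => \sum_(i <- r | P i) f i x).
Proof.
move=> Gf; elim: r => [|i r IH].
  by under eq_fun do rewrite big_nil; exact: genalg_cst.
under eq_fun do rewrite big_cons.
by case: (P i) => //; exact: genalg_add.
Qed.

Lemma genalg_prod (X : Type) (G : (X -> R) -> Prop) (I : Type) (r : seq I)
    (P : pred I) (f : I -> X -> R) : (forall i, genalg G (f i)) ->
  genalg G (fun x => \prod_(i <- r | P i) f i x).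
Proof.
move=> Gf; elim: r => [|i r IH].
  by under eq_fun do rewrite big_nil; exact: genalg_cst.
under eq_fun do rewrite big_cons.
by case: (P i) => //; exact: genalg_mul.
Qed.

Lemma genalg_sub (X : Type) (G : (X -> R) -> Prop) f g :
  genalg G f -> genalg G g -> genalg G (fun x => f x - g x).
Proof.
move=> Gf Gg; under eq_fun do rewrite -mulN1r.
by apply: genalg_add => //; apply: genalg_mul => //; exact: genalg_cst.
Qed.

Lemma genalg_det (X : Type) (G : (X -> R) -> Prop) n (M : X -> 'M[R]_n) :
  (forall i j, genalg G (fun x => M x i j)) -> genalg G (fun x => \det (M x)).
Proof.
move=> GM; apply: genalg_sum => s.
apply: genalg_mul; first exact: genalg_cst.
by apply: genalg_prod.
Qed.

Lemma genalg_comp (X Y : Type) (G : (X -> R) -> Prop) (G' : (Y -> R) -> Prop)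
    (s : Y -> X) f : (forall g, G g -> genalg G' (g \o s)) ->
  genalg G f -> genalg G' (f \o s).
Proof.
move=> GG'; elim=> [g /GG'//|c|g h _ Gg _ Gh|g h _ Gg _ Gh].
- exact: genalg_cst.
- exact: (genalg_add Gg Gh).
- exact: (genalg_mul Gg Gh).
Qed.

Lemma genalg_measurable d (X : measurableType d) (G : (X -> R) -> Prop) f :
  (forall g, G g -> measurable_fun setT g) -> genalg G f ->
  measurable_fun setT f.
Proof.
move=> mG; elim=> [g /mG//|c|g h _ mg _ mh|g h _ mg _ mh].
- exact: measurable_cst.
- exact: measurable_funD.
- exact: measurable_funM.
Qed.

Lemma genalg1_poly (X : Type) (h : X -> R) f :
  genalg (eq h) f -> exists p : {poly R}, f = fun x => p.[h x].
Proof.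
elim=> [_ <-|c|_ _ _ [p ->] _ [q ->]|_ _ _ [p ->] _ [q ->]].
- by exists 'X; apply/funext => x; rewrite hornerX.
- by exists c%:P; apply/funext => x; rewrite hornerC.
- by exists (p + q); apply/funext => x; rewrite hornerD.
- by exists (p * q); apply/funext => x; rewrite hornerM.
Qed.

(** A non-zero polynomial has finitely many roots, and each has at most one preimage under [h]. *)
Lemma genalg1_zeros (h : R -> R) f : injective h -> genalg (eq h) f ->
  (forall x, f x = 0) \/ lebesgue_measure [set x | f x = 0] = 0.
Proof.
move=> hI /genalg1_poly[p ->].
have [->|p0] := eqVneq p 0; first by left=> x; rewrite horner0.
right; apply: countable_lebesgue_measure0; apply: finite_set_countable.
apply: (@finite_preimage _ _ [set y | p.[y] = 0] h) => [x y _ _|].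
  exact: hI.
apply: contrapT => /(infinite_set_fset (size p))[B Bp].
rewrite leqNgt => /negP; apply; apply: max_poly_roots => //;
  last exact: finmap.fset_uniq.
by apply/allP => x xB; apply/rootP; exact: Bp.
Qed.

End generated_algebra.

Definition tuple_gens (R : realType) n (h : 'I_n -> R -> R) :
    (n.-tuple (measurableTypeR R) -> R) -> Prop :=
  fun f => exists i, f = fun t => h i (tnth t i).

Definition tuple2_gens (R : realType) p n (h : 'I_p -> R -> R) :
    (n.-tuple (p.-tuple (measurableTypeR R)) -> R) -> Prop :=
  fun f => exists l j, f = fun t => h j (tnth (tnth t l) j).

Lemma genalg_tuple_measurable (R : realType) n (h : 'I_n -> R -> R) f :
  (forall i, measurable_fun setT (h i)) -> genalg (tuple_gens h) f ->
  measurable_fun setT f.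
Proof.
move=> mh; apply: genalg_measurable => _ [i ->].
apply: (measurableT_comp (mh i)); exact: measurable_tnth.
Qed.

(** Freezing all coordinates but [i] turns each generator into a constant or into [h i]. The
    conclusion stays an alternative because the outer product over components requires this
    alternative of its slices. *)
Lemma genalg_tuple_zeros (R : realType) n (h : 'I_n -> R -> R) f :
  (forall i, measurable_fun setT (h i)) -> (forall i, injective (h i)) ->
  genalg (tuple_gens h) f ->
  (forall t, f t = 0) \/
  prod_measure (@lebesgue_measure R) n [set t | f t = 0] = 0.
Proof.
move=> mh hI Gf.
have [[t ft]|f0] := pselect (exists t, f t != 0); last first.
  by left=> t; apply/eqP/negPn/negP => ft; apply: f0; exists t.
right; apply: prod_measure_zeros; [|move=> u i|by exists t].
  exact: genalg_tuple_measurable Gf.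
apply: (@genalg1_zeros _ (h i) (fun x => f (upd u i x))) => //.
apply: (genalg_comp _ Gf) => _ [j ->].
rewrite /comp; under eq_fun do rewrite tnth_mktuple.
have [->|_] := eqVneq j i; first exact: genalg_gen.
exact: genalg_cst.
Qed.

Lemma genalg_tuple2_measurable (R : realType) p n (h : 'I_p -> R -> R)
    (f : n.-tuple (p.-tuple (measurableTypeR R)) -> R) :
  (forall i, measurable_fun setT (h i)) -> genalg (tuple2_gens h) f ->
  measurable_fun setT f.
Proof.
move=> mh; apply: genalg_measurable => _ [l [j ->]].
apply: (measurableT_comp (mh j)).
by apply: (measurableT_comp (measurable_tnth j)); exact: measurable_tnth.
Qed.

Lemma genalg_tuple2_zeros (R : realType) p n (h : 'I_p -> R -> R)
    (f : n.-tuple (p.-tuple (measurableTypeR R)) -> R) :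
  (forall i, measurable_fun setT (h i)) -> (forall i, injective (h i)) ->
  genalg (tuple2_gens h) f -> (exists t, f t != 0) ->
  prod_measure (prod_measure (@lebesgue_measure R) p) n [set t | f t = 0] = 0.
Proof.
move=> mh hI Gf ft.
have [nu munu] := prod_measure_sigma_finite (@lebesgue_measure R) p.
rewrite munu; apply: prod_measure_zeros => //.
  exact: genalg_tuple2_measurable Gf.
move=> u l; rewrite -munu.
apply: (@genalg_tuple_zeros _ _ h (fun x => f (upd u l x))) => //.
apply: (genalg_comp _ Gf) => _ [l' [j ->]].
rewrite /comp; under eq_fun do rewrite tnth_mktuple.
have [_|_] := eqVneq l' l; last exact: genalg_cst.
by apply: genalg_gen; exists j.
Qed.

(** * The function of the scale seen by one coordinate *)

Lemma measurable_inv (R : realType) : measurable_fun setT (@GRing.inv R).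
Proof.
have -> : [set: R] = [set x | x != 0] `|` [set 0].
  apply/seteqP; split=> // x _ /=.
  by have [->|] := eqVneq x 0; [right|left].
apply/measurable_funU => //.
  by apply: open_measurable; exact: open_neq.
split; last exact: measurable_fun_set1.
apply: open_continuous_measurable_fun; first exact: open_neq.
by move=> x /set_mem x0; exact: inv_continuous.
Qed.

(* For positive [s], the difference of the masses [1/Z] and [q/Z] that one
   coordinate of a Hamming distribution of scale [s] gives to its center and
   to any other letter, with [q = exp (-1/s)] and [Z = 1 + (m - 1) q].
   It is injective on the whole line, and [gap m 0 = 0]. *)
Definition gap (R : realType) (m : nat) (s : R) : R :=
  (1 - expR (- s^-1)) / (1 + (m%:R - 1) * expR (- s^-1)).

Lemma gap0 (R : realType) m : gap m (0 : R) = 0.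
Proof. by rewrite /gap invr0 oppr0 expR0 subrr mul0r. Qed.

Lemma coord_norm_gt0 (R : realType) m (q : R) :
  (1 < m)%N -> 0 < q -> 0 < 1 + (m%:R - 1) * q.
Proof.
move=> m1 q0; have m1R : 1 <= m%:R :> R by rewrite ler1n ltnW.
by rewrite ltr_pwDl// mulr_ge0// ?subr_ge0// ltW.
Qed.

(** In [q = exp (-1/s)] this is a homography: cross-multiplication reduces equality to [m q = m q'].
    Inversion, with [0^-1 = 0], is injective on the whole line. *)
Lemma gap_inj (R : realType) m : (1 < m)%N -> injective (@gap R m).
Proof.
move=> m1 s s' /eqP; rewrite /gap.
have q0 := expR_gt0 (- s^-1); have q0' := expR_gt0 (- s'^-1).
rewrite eqr_div ?lt0r_neq0 ?coord_norm_gt0//.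
move: (@expR_inj R (- s^-1) (- s'^-1)); set q := expR _; set q' := expR _.
move=> qq /eqP e; apply: invr_inj; apply: oppr_inj; apply: qq.
have m0 : m%:R != 0 :> R by rewrite pnatr_eq0 -lt0n ltnW.
by apply: (mulfI m0); lra.
Qed.

Lemma measurable_gap (R : realType) m : (1 < m)%N ->
  measurable_fun setT (@gap R m).
Proof.
move=> m1.
have mq : measurable_fun setT (fun s : R => expR (- s^-1)).
  apply: measurableT_comp; first exact: measurable_expR.
  by apply: measurableT_comp; [exact: oppr_measurable|exact: measurable_inv].
apply: measurable_funM.
  by apply: measurable_funB => //; exact: measurable_cst.
apply: (measurableT_comp (@measurable_inv R)).
apply: measurable_funD; first exact: measurable_cst.
by apply: measurable_funM => //; exact: measurable_cst.
Qed.

(** * Uniqueness of three-way decompositions *)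

Lemma unitmx_col_neq0 (F : fieldType) n (X : 'M[F]_n) l :
  X \in unitmx -> exists i, X i l != 0.
Proof.
move=> uX; apply: contrapT => X0; have /matrixP/(_ l l) := mulVmx uX.
rewrite !mxE eqxx big1 => [/esym/eqP|i _]; first by rewrite oner_eq0.
have [->|Xil] := eqVneq (X i l) 0; first by rewrite mulr0.
by case: X0; exists i.
Qed.

(* [X = A^-1 A'] intertwines the diagonal matrices of [s] and [s'], and the
   entries of [s] are distinct, so [X] is monomial; the rows of ones in [A] and
   [A'] then force its non-zero entries to be 1. *)
Lemma joint_diagonalization_unique (F : fieldType) n (A B A' B' : 'M[F]_n)
    (d d' s s' : 'I_n -> F) (i0 : 'I_n) :
  A \in unitmx -> B \in unitmx -> (forall l, d l != 0) -> injective s ->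
  (forall l, A i0 l = 1) -> (forall l, A' i0 l = 1) ->
  (forall l, B i0 l = 1) -> (forall l, B' i0 l = 1) ->
  (forall i k, \sum_l d l * (A i l * B k l) =
               \sum_l d' l * (A' i l * B' k l)) ->
  (forall i k, \sum_l d l * (A i l * B k l * s l) =
               \sum_l d' l * (A' i l * B' k l * s' l)) ->
  exists tau : {perm 'I_n}, forall l,
    [/\ d' l = d (tau l), forall i, A' i l = A i (tau l) &
        forall i, B' i l = B i (tau l)].
Proof.
move=> uA uB d0 sI A1 A1' B1 B1' AB ABs.
pose D (u : 'I_n -> F) : 'M[F]_n := diag_mx (\row_l u l).
have DE (M N : 'M[F]_n) u i k :
    (M *m (D u *m N^T)) i k = \sum_l u l * (M i l * N k l).
  rewrite !mxE; apply: eq_bigr => l _.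
  rewrite mul_diag_mx !mxE; ring.
have DsE (M N : 'M[F]_n) u v i k :
    (M *m (D v *m (D u *m N^T))) i k = \sum_l u l * (M i l * N k l * v l).
  rewrite !mxE; apply: eq_bigr => l _.
  rewrite !mul_diag_mx !mxE; ring.
have E : A *m (D d *m B^T) = A' *m (D d' *m B'^T).
  by apply/matrixP => i k; rewrite !DE AB.
have Es : A *m (D s *m (D d *m B^T)) = A' *m (D s' *m (D d' *m B'^T)).
  by apply/matrixP => i k; rewrite !DsE ABs.
have uD : D d \in unitmx.
  rewrite unitmxE det_diag unitfE; apply/prodf_neq0 => l _.
  by rewrite mxE.
(* Nothing is assumed invertible on the primed side; it inherits invertibility from this common
   product. *)
have : A *m (D d *m B^T) \in unitmx by rewrite !unitmx_mul uA uD unitmx_tr.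
rewrite E unitmx_mul => /andP[uA' uDB'].
pose X := invmx A *m A'.
have uX : X \in unitmx by rewrite unitmx_mul unitmx_inv uA.
have AX : A *m X = A' by rewrite mulKVmx.
have EX : D d *m B^T = X *m (D d' *m B'^T).
  by rewrite /X -mulmxA -E mulKmx.
clearbody X.
(* Multiplied by [A] on the left and by [D d' *m B'^T] on the right, both sides become the two
   expressions in [Es]. *)
have : D s *m X = X *m D s'.
  rewrite -[LHS](mulmxK uDB') -[RHS](mulmxK uDB'); congr (_ *m _).
  rewrite -mulmxA -EX -mulmxA; apply: (can_inj (mulKmx uA)).
  by rewrite Es -AX -mulmxA.
move=> /matrixP Xs.
have {Xs} sX i l : X i l != 0 -> s i = s' l.
  move=> Xil; have := Xs i l; rewrite mul_diag_mx mul_mx_diag !mxE mulrC.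
  exact: (mulfI Xil).
have /choice[t Xt] := fun l => unitmx_col_neq0 l uX.
have tX i l : X i l != 0 -> i = t l.
  by move=> /sX e; apply: sI; rewrite e (sX _ _ (Xt l)).
have /choice[u Xu] i : exists l, X i l != 0.
  have uXT : X^T \in unitmx by rewrite unitmx_tr.
  by have [l] := unitmx_col_neq0 i uXT; rewrite mxE => ?; exists l.
(* A non-zero entry in column [l] can only lie in row [t l], so [t] is a left inverse of [u]. *)
have uI : injective u.
  by apply: (can_inj (g := t)) => i; rewrite -(tX _ _ (Xu i)).
pose tau := (perm uI)^-1%g.
have tE l : t l = tau l.
  by have := tX _ _ (Xu (tau l)); rewrite -[u _](permE uI) permKV.
have tau_eq i l : X i l != 0 -> i = tau l by rewrite -tE; exact: tX.
have A'E i l : A' i l = A i (tau l) * X (tau l) l.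
  rewrite -AX mxE (bigD1 (tau l))//= big1 ?addr0// => i' i'l.
  have [->|/tau_eq i'E] := eqVneq (X i' l) 0; first by rewrite mulr0.
  by rewrite i'E eqxx in i'l.
have X1 l : X (tau l) l = 1 by rewrite -(A1' l) A'E A1 mul1r.
have dB k l : d (tau l) * B k (tau l) = d' l * B' k l.
  have /matrixP/(_ (tau l) k) := EX.
  rewrite mul_diag_mx !mxE (bigD1 l)//= X1 mul1r big1 ?addr0 => [|l' l'l].
    by rewrite mul_diag_mx !mxE.
  have [->|/tau_eq/perm_inj l'E] := eqVneq (X (tau l) l') 0.
    by rewrite mul0r.
  by rewrite l'E eqxx in l'l.
have dE l : d' l = d (tau l) by have := dB i0 l; rewrite B1 B1' !mulr1.
exists tau => l; split => // i; first by rewrite A'E X1 mulr1.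
by have := dB i l; rewrite dE => /(mulfI (d0 _)).
Qed.

(** After reindexing by [tau], the hypothesis says that [A] kills the vector of entries
    [d l * (e l - e' (tau^-1 l))]. *)
Lemma unitmx_weighted_sum_inj (F : fieldType) n (A : 'M[F]_n)
    (d e e' : 'I_n -> F) (tau : {perm 'I_n}) :
  A \in unitmx -> (forall l, d l != 0) ->
  (forall i, \sum_l d (tau l) * (A i (tau l) * e' l) =
             \sum_l d l * (A i l * e l)) ->
  forall l, e' l = e (tau l).
Proof.
move=> uA d0 h l.
pose v : 'cV[F]_n := \col_l (d l * (e l - e' (tau^-1%g l))).
have : A *m v = 0.
  apply/colP => i; rewrite !mxE; have := h i.
  rewrite (reindex_inj (@perm_inj _ tau^-1%g)) => /eqP.
  rewrite eq_sym -subr_eq0 -sumrB => /eqP h0; rewrite -[RHS]h0.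
  by apply: eq_bigr => l' _; rewrite mxE permKV; ring.
move=> /(canRL (mulKmx uA)); rewrite mulmx0 => /colP/(_ (tau l)).
rewrite !mxE permK => /eqP; rewrite mulf_eq0 (negbTE (d0 _))/= subr_eq0.
by move=> /eqP.
Qed.

(** * Invertibility of matrices of block products *)

Lemma bits_subset_leq k i l :
  (forall j, (j < k)%N -> odd (i %/ 2 ^ j) -> odd (l %/ 2 ^ j)) ->
  (i < 2 ^ k)%N -> (i <= l)%N.
Proof.
elim: k i l => [|k IH] i l il; first by rewrite expn0 ltnS leqn0 => /eqP->.
rewrite expnS => ik.
have : (i./2 <= l./2)%N.
  apply: IH => [j jk|]; last by lia.
  by rewrite -!divn2 -!divnMA -!expnS; exact: il.
have := il 0%N isT; rewrite expn0 !divn1.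
move: (odd_double_half i) (odd_double_half l).
by case: odd; case: odd => //=; lia.
Qed.

(** The binary digits of [i] encode a subset of the block of [k] coordinates starting at [o]. When
    [L <= 2 ^ k], the numbers below [L] encode distinct subsets, which index the rows of a square
    matrix. *)
Definition bit_block (p o k i : nat) : pred 'I_p :=
  fun j => (o <= j < o + k)%N && odd (i %/ 2 ^ (j - o)).

(* For [L = 2 ^ k] this is the column-wise Kronecker product of the 2 x L
   matrices with rows [1] and [t _ j], for [o <= j < o + k]. *)
Definition khatri_rao (F : fieldType) (p L o k : nat)
    (t : 'I_L -> 'I_p -> F) : 'M[F]_L :=
  \matrix_(i, l) \prod_(j | bit_block o k i j) t l j.

(* Row [i] and column [l] meet in a non-zero entry exactly when the bits of
   [i] are among those of [l]; then [i <= l], so the matrix is triangular. *)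
Lemma khatri_rao_bits_det_neq0 (F : fieldType) (p L o k : nat)
    (w : 'I_L -> 'I_p -> F) :
  (o + k <= p)%N -> (L <= 2 ^ k)%N -> (forall l j, w l j != 0) ->
  \det (khatri_rao o k
    (fun l j => if odd (l %/ 2 ^ (j - o)) then w l j else 0)) != 0.
Proof.
move=> okp Lk w0; rewrite -det_tr det_trig.
  apply/prodf_neq0 => l _; rewrite !mxE; apply/prodf_neq0 => j.
  by rewrite /bit_block => /andP[_ ->].
apply/is_trig_mxP => l i li; rewrite !mxE; apply/eqP; apply: contraTT li.
move=> /prodf_neq0 h; rewrite -leqNgt.
apply: (@bits_subset_leq k); last exact: leq_trans (ltn_ord i) Lk.
move=> j jk ij; have jp : (o + j < p)%N by lia.
have := h (Ordinal jp); rewrite /bit_block/= addKn ij andbT.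
by case: odd => // /(_ _)/negP; rewrite eqxx; case; lia.
Qed.

(** The number 0 encodes the empty subset; this is the row of ones that normalizes the
    diagonalization. *)
Lemma khatri_rao0 (F : fieldType) (p L o k : nat) (t : 'I_L -> 'I_p -> F)
    (i l : 'I_L) : i = 0%N :> nat -> khatri_rao o k t i l = 1.
Proof.
by move=> i0; rewrite mxE big1// => j; rewrite /bit_block i0 div0n andbF.
Qed.

(** * Moments of Hamming mixtures *)

Lemma sum_dffun_prod (R : comNzSemiRingType) (I : finType) (T_ : I -> finType)
    (F : forall i, T_ i -> R) :
  \sum_(x : {dffun forall i, T_ i}) \prod_i F i (x i) =
  \prod_i \sum_(a : T_ i) F i a.
Proof.
rewrite (reindex (@dffun_of_fprod _ T_)); last exact/onW_bij/dffun_of_fprod_bij.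
transitivity (\sum_(t : fprod T_) \prod_(i in I) [ffun a => F i a] (t i)).
  by apply: eq_bigr => t _; apply: eq_bigr => i _; rewrite !ffunE.
rewrite big_fprod; apply: (etrans (esym (bigA_distr_big_dep
  (fun i u => tagged_with T_ i u) (fun i => untag 0 [ffun a => F i a])))) => /=.
apply: eq_bigr => i _; rewrite -(big_tag (fun i => [ffun a => F i a])).
by apply: eq_bigr => a _; rewrite ffunE.
Qed.

Definition coord_pmf (R : realType) (T : finType) (c : T) (s : R) (a : T) : R :=
  (if a == c then 1 else expR (- s^-1)) /
  (1 + (#|T|%:R - 1) * expR (- s^-1)).

Lemma hamming_pmfE (R : realType) (p : nat) (A : 'I_p -> finType)
    (c : Omega A) (s : 'I_p -> R) (x : Omega A) :
  hamming_pmf c s x = \prod_j coord_pmf (c j) (s j) (x j).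
Proof.
rewrite /hamming_pmf -sumrN expR_sum -prodfV -big_split/=.
apply: eq_bigr => j _; rewrite /coord_pmf mulrC div1r -expRN.
case: eqP => _; first by rewrite subrr mul0r oppr0 expR0.
by rewrite subr0 div1r.
Qed.

Definition coord_mean (R : realType) (T : finType) (c : T) (s : R)
    (f : T -> R) : R :=
  \sum_a coord_pmf c s a * f a.

(* Sums to zero and vanishes nowhere, so that its mean under a one-coordinate
   Hamming law is a non-zero multiple of [gap], whatever the center is. *)
Definition contrast (R : realType) (T : finType) (a0 a : T) : R :=
  1 - #|T|%:R * (a == a0)%:R.

Lemma contrast_neq0 (R : realType) (T : finType) (a0 a : T) :
  (1 < #|T|)%N -> contrast R a0 a != 0.
Proof.
move=> T1; rewrite /contrast; case: (a =P a0) => _;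
  rewrite ?mulr0 ?subr0 ?oner_eq0//.
by rewrite mulr1 subr_eq0 eq_sym pnatr_eq1 gtn_eqF.
Qed.

Lemma sum_contrast (R : realType) (T : finType) (a0 : T) :
  \sum_a contrast R a0 a = 0.
Proof.
rewrite big_split/= sumr_const (bigD1 a0)//= eqxx mulr1 big1.
  by rewrite addr0 subrr.
by move=> a /negbTE->; rewrite mulr0 oppr0.
Qed.

(** With [q] and [Z] as for [gap], the law gives [q/Z] to every letter and an extra [(1 - q)/Z] to
    [c]. *)
Lemma coord_meanE (R : realType) (T : finType) (c : T) (s : R) f :
  coord_mean c s f =
  (f c * (1 - expR (- s^-1)) + expR (- s^-1) * \sum_a f a) /
  (1 + (#|T|%:R - 1) * expR (- s^-1)).
Proof.
rewrite /coord_mean /coord_pmf (bigD1 c)//= eqxx.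
rewrite [X in _ = (_ + _ * X) / _](bigD1 c)//=.
set q := expR _; set Z := 1 + _.
rewrite (eq_bigr (fun a => q / Z * f a)) => [|a /negbTE->//].
by rewrite -mulr_sumr; ring.
Qed.

Lemma coord_mean1 (R : realType) (T : finType) (c : T) (s : R) :
  (1 < #|T|)%N -> coord_mean c s (fun=> 1) = 1.
Proof.
move=> T1; rewrite coord_meanE sumr_const; set q := expR _.
have /lt0r_neq0 Z0 : 0 < 1 + (#|T|%:R - 1) * q.
  by rewrite coord_norm_gt0 ?expR_gt0.
by rewrite -[RHS](divff Z0); congr (_ / _); ring.
Qed.

Lemma coord_mean_contrast (R : realType) (T : finType) (a0 c : T) (s : R) :
  coord_mean c s (contrast R a0) = contrast R a0 c * gap #|T| s.
Proof. by rewrite coord_meanE sum_contrast mulr0 addr0 mulrA. Qed.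

Lemma coord_mean_indic (R : realType) (T : finType) (c : T) (s : R) a :
  coord_mean c s (fun b => (b == a)%:R) = coord_pmf c s a.
Proof.
rewrite /coord_mean (bigD1 a)//= eqxx mulr1 big1 ?addr0//.
by move=> b /negbTE->; rewrite mulr0.
Qed.

(** For a positive scale the center is the unique mode; the drop in mass from it to any other letter
    is [gap], which determines the scale. *)
Lemma coord_pmf_inj (R : realType) (T : finType) (c c' : T) (s s' : R) :
  (1 < #|T|)%N -> 0 < s -> 0 < s' ->
  (forall a, coord_pmf c s a = coord_pmf c' s' a) -> c = c' /\ s = s'.
Proof.
move=> T1 s0 s0' cc'.
have lt1 (u : R) : 0 < u -> expR (- u^-1) < 1 :> R.
  by move=> u0; rewrite -expR0 ltr_expR oppr_lt0 invr_gt0.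
have pmf_lt (b b' : T) (u : R) : 0 < u -> b != b' ->
    coord_pmf b u b' < coord_pmf b u b.
  move=> u0 bb'; rewrite /coord_pmf eqxx eq_sym (negbTE bb').
  by rewrite ltr_pM2r ?lt1 ?invr_gt0 ?coord_norm_gt0 ?expR_gt0.
have ecc : c = c'.
  apply/eqP/negPn/negP => nc.
  have := pmf_lt _ _ _ s0 nc; rewrite !cc' ltNge => /negP; apply.
  by apply/ltW/pmf_lt => //; rewrite eq_sym.
split=> //; move: cc'; rewrite -{c'}ecc => cc'.
apply: (@gap_inj R _ T1).
have /card_gt1P[x [y [_ _ xy]]] := T1.
have gapE a (u : R) : a != c -> gap #|T| u = coord_pmf c u c - coord_pmf c u a.
  by move=> /negbTE ac; rewrite /coord_pmf ac eqxx -mulrBl.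
have [xc|xc] := eqVneq x c.
  by rewrite !(gapE y) -?xc 1?eq_sym// xc !cc'.
by rewrite !(gapE x)// !cc'.
Qed.

Section moments.
Variables (R : realType) (p : nat) (A : 'I_p -> finType) (L : nat).
Hypothesis A1 : forall j, (1 < #|A j|)%N.
Variable x0 : Omega A.
Implicit Types th : mix_param R A L.

Definition mean th l j (f : A j -> R) : R :=
  coord_mean (Defs.center th l j) (scale th l j) f.

Definition contrast_mean th (l : 'I_L) (j : 'I_p) : R :=
  mean th l (contrast R (x0 j)).

Lemma mixture_moment th (f : forall j, A j -> R) :
  \sum_x mixture_pmf th x * \prod_j f j (x j) =
  \sum_l weight th l * \prod_j mean th l (f j).
Proof.
under eq_bigr do rewrite mulr_suml.
rewrite exchange_big/=; apply: eq_bigr => l _.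
rewrite -sum_dffun_prod mulr_sumr; apply: eq_bigr => x _.
by rewrite hamming_pmfE -mulrA -big_split.
Qed.

(** In use, [P] is a subset of one or both blocks, and [f] is the constant 1, the contrast at a
    third coordinate, or a function whose mean is to be recovered. *)
Lemma moment_eq th th' (P : pred 'I_p) (j : 'I_p) (f : A j -> R) :
  (forall x, mixture_pmf th' x = mixture_pmf th x) -> ~~ P j ->
  \sum_l weight th l * (\prod_(i | P i) contrast_mean th l i * mean th l f) =
  \sum_l weight th' l * (\prod_(i | P i) contrast_mean th' l i * mean th' l f).
Proof.
move=> hh Pj.
pose F i : A i -> R := if P i then contrast R (x0 i) else
  eqtype.dfwith (fun i (_ : A i) => 1) f i.
have FE th0 l : \prod_i mean th0 l (F i) =
    \prod_(i | P i) contrast_mean th0 l i * mean th0 l f.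
  rewrite (bigID P)/=; congr (_ * _).
    by apply: eq_bigr => i Pi; rewrite /F Pi.
  rewrite (bigD1 j)//= {1}/F (negbTE Pj) dfwith_in big1 ?mulr1//.
  move=> i /andP[Pi ij].
  by rewrite /F (negbTE Pi) dfwith_out 1?eq_sym// /mean coord_mean1.
under eq_bigr do rewrite -FE; under [RHS]eq_bigr do rewrite -FE.
by rewrite -!mixture_moment; apply: eq_bigr => x _; rewrite hh.
Qed.

Lemma identifiable_of_khatri_rao th (k : nat) (j0 : 'I_p) :
  (0 < L)%N -> j0 = (2 * k)%N :> nat ->
  admissible th ->
  (forall l, weight th l != 0) ->
  \det (khatri_rao 0 k (contrast_mean th)) != 0 ->
  \det (khatri_rao k k (contrast_mean th)) != 0 ->
  injective (fun l => contrast_mean th l j0) ->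
  identifiable th.
Proof.
move=> L0 j0E [_ _ sg0] w0 det1 det2 t_inj th' [_ _ sg0'] hh.
pose K th0 o := khatri_rao o k (contrast_mean th0).
have uK1 : K th 0%N \in unitmx by rewrite unitmxE unitfE.
have uK2 : K th k \in unitmx by rewrite unitmxE unitfE.
pose i0 := Ordinal L0.
have K0 th0 o l : K th0 o i0 l = 1 by exact: khatri_rao0.
have mean1 th0 l j : mean th0 l (fun _ : A j => 1) = 1.
  by rewrite /mean coord_mean1.
(* The two blocks are disjoint, so the product over [P i i'] factors into one entry of each
   matrix. *)
pose P i i' : pred 'I_p :=
  fun j => bit_block 0 k i j || bit_block k k i' j.
have PE th0 (i i' l : 'I_L) : \prod_(j | P i i' j) contrast_mean th0 l j =
    K th0 0%N i l * K th0 k i' l.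
  rewrite !mxE (bigID (fun j : 'I_p => j < k)%N)/=; congr (_ * _).
    apply: eq_bigl => j; rewrite /P /bit_block.
    by case: (odd _); case: (odd _); rewrite ?andbF ?andbT ?orbF/=; lia.
  apply: eq_bigl => j; rewrite /P /bit_block.
  by case: (odd _); case: (odd _); rewrite ?andbF ?andbT ?orbF/=; lia.
have Pj0 i i' : ~~ P i i' j0.
  by rewrite /P /bit_block j0E negb_or !negb_and; lia.
have h1 i i' : \sum_l weight th l * (K th 0%N i l * K th k i' l) =
    \sum_l weight th' l * (K th' 0%N i l * K th' k i' l).
  have := moment_eq (fun=> 1) hh (Pj0 i i').
  by under eq_bigr do rewrite PE mean1 mulr1;
     under [RHS]eq_bigr do rewrite PE mean1 mulr1.
have h2 i i' :
    \sum_l weight th l *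
      (K th 0%N i l * K th k i' l * contrast_mean th l j0) =
    \sum_l weight th' l *
      (K th' 0%N i l * K th' k i' l * contrast_mean th' l j0).
  have := moment_eq (contrast R (x0 j0)) hh (Pj0 i i').
  by under eq_bigr do rewrite PE; under [RHS]eq_bigr do rewrite PE.
have [tau htau] := joint_diagonalization_unique uK1 uK2 w0 t_inj
  (K0 th 0%N) (K0 th' 0%N) (K0 th k) (K0 th' k) h1 h2.
(* The moments of [f] against the products over a block form a linear system with invertible matrix
   [K th o]. Every coordinate lies outside at least one of the two blocks. *)
have block_mean (o : nat) (j : 'I_p) (f : A j -> R) l :
    K th o \in unitmx ->
    (forall l i, K th' o i l = K th o i (tau l)) ->
    ~~ (o <= j < o + k)%N -> mean th' l f = mean th (tau l) f.
  move=> uK Ktau jo.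
  apply: (unitmx_weighted_sum_inj (e := fun l => mean th l f)
    (e' := fun l => mean th' l f) uK w0) => i.
  have Pj : ~~ bit_block o k i j by rewrite /bit_block (negbTE jo).
  have := moment_eq f hh Pj.
  transitivity (\sum_l weight th' l * (K th' o i l * mean th' l f)).
    apply: eq_bigr => l' _; have [-> _ _] := htau l'.
    by rewrite Ktau.
  under eq_bigr do rewrite mxE; under [RHS]eq_bigr do rewrite mxE.
  exact: esym.
have meanE j (f : A j -> R) l :
    mean th' l f = mean th (tau l) f.
  have [jk|kj] := ltnP j k.
    apply: (block_mean k) => //; last by rewrite negb_and -ltnNge jk.
    by move=> l' i; have [] := htau l'.
  apply: (block_mean 0%N) => //; last by rewrite add0n -leqNgt.
  by move=> l' i; have [] := htau l'.
exists tau => l.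
have cs j : Defs.center th' l j = Defs.center th (tau l) j /\
            scale th' l j = scale th (tau l) j.
  apply: coord_pmf_inj => // a.
  by rewrite -!coord_mean_indic; exact: meanE.
have [wE _ _] := htau l.
split=> [//||j]; last by have [] := cs j.
by apply/ffunP => j; have [] := cs j.
Qed.

End moments.

(** * Generic identifiability *)

Lemma contrast_meanE (R : realType) (p : nat) (A : 'I_p -> finType) (L : nat)
    (x0 : Omega A) (th : mix_param R A L) l j :
  contrast_mean x0 th l j =
  contrast R (x0 j) (Defs.center th l j) * gap #|A j| (scale th l j).
Proof. exact: coord_mean_contrast. Qed.

Lemma ceil_log2P (R : realType) (L : nat) : (0 < L)%N ->
  exists2 k : nat, Num.ceil (ln (L%:R : R) / ln 2) = k :> int & (L <= 2 ^ k)%N.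
Proof.
move=> L0; have ln2 : 0 < ln 2 :> R by rewrite ln_gt0// ltr1n.
have : (0 <= Num.ceil (ln (L%:R : R) / ln 2))%R.
  rewrite ceil_ge0 (@lt_le_trans _ _ 0)// ?ltrN10//.
  by apply: divr_ge0; [rewrite ln_ge0// ler1n|exact: ltW].
case E : (Num.ceil _) => [k|//] _; exists k => //.
have := ceil_ge (ln (L%:R : R) / ln 2); rewrite E.
rewrite ler_pdivrMr// mulrC mulr_natr -lnXn// ler_ln ?posrE ?ltr0n ?exprn_gt0//.
by rewrite -natrX ler_nat.
Qed.

Lemma negligible_exists d (T : measurableType d) (R : realType)
    (mu : {measure set T -> \bar R}) (I : finType) (F : I -> set T) :
  (forall i, mu.-negligible (F i)) -> mu.-negligible [set x | exists i, F i x].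
Proof.
move=> NF; apply: (@negligibleS _ _ _ _ (\big[setU/set0]_i F i)).
  by move=> x [i Fix]; rewrite (bigD1 i)//=; left.
apply: (big_ind (fun X => mu.-negligible X)) => //.
- exact: negligible_set0.
- by move=> X Y; exact: negligibleU.
Qed.

Lemma negligible_fst d1 d2 (T1 : measurableType d1) (T2 : measurableType d2)
    (R : realType) (m1 : {measure set T1 -> \bar R})
    (m2 : {sigma_finite_measure set T2 -> \bar R}) (N : set T1) :
  measurable N -> m1 N = 0%E ->
  (product_measure1 m1 m2).-negligible [set z | N z.1].
Proof.
move=> mN N0; exists (N `*` setT); split; first exact: measurableX.
  by rewrite product_measure1E// N0 mul0e.
by move=> z Nz; split.
Qed.

Lemma negligible_snd d1 d2 (T1 : measurableType d1) (T2 : measurableType d2)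
    (R : realType) (m1 : {measure set T1 -> \bar R})
    (m2 : {sigma_finite_measure set T2 -> \bar R}) (N : set T2) :
  measurable N -> m2 N = 0%E ->
  (product_measure1 m1 m2).-negligible [set z | N z.2].
Proof.
move=> mN N0; exists (setT `*` N); split; first exact: measurableX.
  by rewrite product_measure1E// N0 mule0.
by move=> z Nz; split.
Qed.

(** The coordinates of the simplex omit the last weight, which is restored from the total mass 1. *)
Definition full_weight (R : realType) n (u : n.-tuple R) (l : 'I_n.+1) : R :=
  if unlift ord_max l is Some i then tnth u i else 1 - \sum_i tnth u i.

Lemma full_weightE (R : realType) (p : nat) (A : 'I_p -> finType) n
    (th : mix_param R A n.+1) l :
  admissible th -> full_weight (continuous_coords th).1 l = weight th l.
Proof.
move=> [_ w1 _]; rewrite /full_weight.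
have wE i : widen_ord (leq_pred n.+1) i = lift ord_max i.
  by apply: val_inj; rewrite [RHS]lift_max.
case: unliftP => [i ->|->]; first by rewrite tnth_mktuple wE.
under eq_bigr do rewrite tnth_mktuple.
rewrite -w1 big_ord_recr/= addrAC addrC [X in _ + X](_ : _ = 0) ?addr0//.
apply/eqP; rewrite subr_eq0; apply/eqP/eq_bigr => i _.
by congr (weight th _); exact: val_inj.
Qed.

Lemma full_weight_zeros (R : realType) n (l : 'I_n.+1) :
  let N := [set u : n.-tuple (measurableTypeR R) | full_weight u l = 0] in
  measurable N /\ prod_measure (@lebesgue_measure R) n N = 0%E.
Proof.
pose h (i : 'I_n) : R -> R := id.
have Gi i : genalg (tuple_gens h) (fun t => tnth t i).
  by apply: genalg_gen; exists i.
have G : genalg (tuple_gens h) (fun u => full_weight u l).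
  rewrite /full_weight; case: (unlift _ _) => [i|]; first exact: Gi.
  by apply: genalg_sub; [exact: genalg_cst|exact: genalg_sum].
have mh i : measurable_fun setT (h i) by exact: measurable_id.
split; first by apply: measurable_zeros; exact: genalg_tuple_measurable G.
have [f0|//] := genalg_tuple_zeros mh (fun i => @inj_id R) G.
(* All ones for a free weight, all zeros for the last one: in both cases the weight of [l] is 1. *)
have := f0 [tuple (unlift ord_max l != None)%:R | i < n]; rewrite /full_weight.
case: (unlift _ _) => [i|]/=.
  by rewrite tnth_mktuple => /eqP; rewrite oner_eq0.
rewrite big1 => [/eqP|i _]; last by rewrite tnth_mktuple.
by rewrite subr0 oner_eq0.
Qed.

Theorem theorem3p1 (R : realType) (p : nat) (A : 'I_p -> finType) (L : nat)
    (hp : (3 <= p)%N) (hA : forall j : 'I_p, (2 <= #|A j|)%N) (hL : (1 <= L)%N)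
    (hpL : 2 * Num.ceil (ln (L%:R : R) / ln 2) + 1 <= (Posz p)) :
  generically_identifiable R A L.
Proof.
have [k kE Lk] := ceil_log2P R hL.
have kp : (2 * k < p)%N by move: hpL; rewrite kE; lia.
case: L hL Lk hpL kE => // n hL Lk _ _ c.
pose x0 := c ord0; pose j0 := Ordinal kp.
pose h j := @gap R #|A j|.
have mh j : measurable_fun setT (h j) by exact: measurable_gap.
have hI j : injective (h j) by exact: gap_inj.
pose w (l : 'I_n.+1) j : R := contrast R (x0 j) (c l j).
have w0 l j : w l j != 0 by exact: contrast_neq0.
pose S := n.+1.-tuple (p.-tuple (measurableTypeR R)).
pose t (s : S) l j : R := w l j * h j (tnth (tnth s l) j).
have Gt l j : genalg (tuple2_gens h) (fun s : S => t s l j).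
  apply: genalg_mul; first exact: genalg_cst.
  by apply: genalg_gen; exists l, j.
have Gdet o : genalg (tuple2_gens h) (fun s : S => \det (khatri_rao o k (t s))).
  apply: genalg_det => i l; under eq_fun do rewrite mxE.
  exact: genalg_prod.
have h1 j : h j 1 != 0 by rewrite -(gap0 R #|A j|) (inj_eq (hI j)) oner_eq0.
have det0 o : (o + k <= p)%N -> exists s : S, \det (khatri_rao o k (t s)) != 0.
  move=> okp; pose b (l : 'I_n.+1) (j : 'I_p) := odd (l %/ 2 ^ (j - o)).
  (* Scale 1 where the bit is set and 0 elsewhere: as [gap] vanishes at 0, this is the triangular
     case. Scale 0 is not admissible, but the zero set is measured in the whole space. *)
  exists [tuple [tuple (b l j)%:R | j < p] | l < n.+1].
  rewrite [X in khatri_rao o k X](_ : _ =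
      fun l j => if b l j then w l j * h j 1 else 0).
    by apply: khatri_rao_bits_det_neq0 => // l j; rewrite mulf_neq0.
  apply/funext => l; apply/funext => j; rewrite /t !tnth_mktuple.
  by case: (b l j) => //; rewrite [h j _]gap0 mulr0.
have Gd l l' : genalg (tuple2_gens h) (fun s : S => t s l j0 - t s l' j0).
  exact: genalg_sub.
have d0 l l' : l != l' -> exists s : S, t s l j0 - t s l' j0 != 0.
  rewrite eq_sym => /negbTE l'l.
  exists [tuple [tuple (i == l)%:R | j < p] | i < n.+1].
  rewrite /t !tnth_mktuple eqxx l'l [h j0 0%:R]gap0.
  by rewrite mulr0 subr0 mulf_neq0.
have [nu1 nu1E] := prod_measure_sigma_finite (@lebesgue_measure R) n.
have [nu2 nu2E] := prod_measure_sigma_finite (@lebesgue_measure R) p.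
have [nu3 nu3E] := prod_measure_sigma_finite nu2 n.+1.
have null f : genalg (tuple2_gens h) f -> (exists s : S, f s != 0) ->
    (product_measure1 nu1 nu3).-negligible [set z | f z.2 = 0].
  move=> Gf f0; apply: (@negligible_snd _ _ _ _ _ _ _ [set s | f s = 0]).
    by apply: measurable_zeros; exact: genalg_tuple2_measurable Gf.
  by rewrite -nu3E -nu2E; exact: genalg_tuple2_zeros.
rewrite /coords_lebesgue nu1E nu2E nu3E.
have N1 := negligible_exists (fun l => negligible_fst nu3
  (proj1 (full_weight_zeros R l)) (etrans (esym (congr1 (fun m => m _) nu1E))
  (proj2 (full_weight_zeros R l)))).
have N2 := null _ (Gdet 0%N) (det0 0%N _).
have N3 := null _ (Gdet k) (det0 k _).
have N4 : (product_measure1 nu1 nu3).-negligible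
    [set z | exists q : 'I_n.+1 * 'I_n.+1, q.1 != q.2 /\
             t z.2 q.1 j0 - t z.2 q.2 j0 = 0].
  apply: negligible_exists => -[l l'] /=.
  have [->|ll'] := eqVneq l l'; last first.
    by apply: negligibleS (null _ (Gd l l') (d0 _ _ ll')) => z [].
  by apply: negligibleS (negligible_set0 _) => z [].
have N34 := negligibleU (N3 _) N4.
(* Outside these four null sets the weights are non-zero, both determinants are non-zero and the
   means at [j0] are distinct. *)
apply: negligibleS (negligibleU N1 (negligibleU (N2 _) (N34 _))); [|lia|lia].
move=> _ [th [ath cth nth] <-]; apply: contrapT => nN; apply: nth.
have tE : t (continuous_coords th).2 = contrast_mean x0 th.
  apply/funext => l; apply/funext => j.
  by rewrite contrast_meanE /t /w /h cth !tnth_mktuple.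
apply: (@identifiable_of_khatri_rao _ _ _ _ _ x0 th k j0) => //.
- move=> l; apply/eqP => wl; apply: nN; left; exists l.
  by rewrite /= full_weightE.
- by apply/eqP => e; apply: nN; right; left; rewrite /= tE.
- by apply/eqP => e; apply: nN; right; right; left; rewrite /= tE.
- move=> l l' /= e; apply/eqP/negPn/negP => ll'; apply: nN; do 3 right.
  by exists (l, l'); rewrite /= tE e subrr.
Qed.
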